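(* Let $n\ge 3$ and $m\ge 2$ be integers and consider the wheel-based self-similar graphs $G^{(i)}=G^{(i,m,n)}$ defined in the context. For $k\ge 0$ let $|V^{(k)}|$ denote the number of vertices of $G^{(k-1)}$, where $G^{(-1)}$ is a single vertex (so $|V^{(0)}|=1$, $|V^{(1)}|=n+1$). Then for every $i\ge 0$ the number of spanning trees of $G^{(i)}$ is $$\tau\big(G^{(i,m,n)}\big)=\left(L_{2n}-2\right)^{\sum_{j=0}^{i}|V^{(j)}|}\; m^{\,n\sum_{j=0}^{i}(i-j)|V^{(j)}|},$$ where $L_k$ is the $k$-th Lucas number ($L_1=1$, $L_2=3$, $L_{k+2}=L_{k+1}+L_k$).
   Context: $W_n$ denotes the wheel with $n+1$ vertices and $2n$ edges: a cycle $C_n$ (the rim) together with a hub vertex adjacent to all rim vertices. The edge-path transformation replaces every edge of a graph by a path of length $m$ (inserting $m-1$ new internal vertices on each edge). The wheel-based model: $G^{(0)}=W_n$, and for $i\ge 0$, $G^{(i+1)}$ is obtained from $G^{(i)}$ by first applying the edge-path transformation, and then, for every vertex $v$ of $G^{(i)}$ (i.e. every vertex present before the subdivision), attaching a new copy of $W_n$ by identifying $v$ with a rim (non-hub) vertex of that copy. $\tau(G)$ denotes the number of spanning trees of $G$. *)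

(* Defs.v *)
From mathcomp Require Import all_boot.

Set Implicit Arguments.
Unset Strict Implicit.
Unset Printing Implicit Defensive.

Record sgraph := SGraph {
  vert :> finType;
  adj : rel vert;
  adj_sym : symmetric adj;
  adj_irr : irreflexive adj
}.
Arguments adj {s} _ _ : rename.

Section Symmetrize.
Variables (T : finType) (e : rel T).

Definition symm_rel : rel T := [rel x y | (x != y) && (e x y || e y x)].

Lemma symm_rel_sym : symmetric symm_rel.
Proof. by move=> x y; rewrite /symm_rel /= eq_sym orbC. Qed.

Lemma symm_rel_irr : irreflexive symm_rel.
Proof. by move=> x; rewrite /symm_rel /= eqxx. Qed.

Definition graph_of_rel : sgraph := SGraph symm_rel_sym symm_rel_irr.
End Symmetrize.

(* Spanning trees are identified with their edge sets; edges are unordered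
   pairs of vertices. *)
Definition edge_set (G : sgraph) : {set {set G}} :=
  [set e : {set G} | [exists x : G, exists y : G, adj x y && (e == [set x; y])]].

Definition rel_of_edges (T : finType) (F : {set {set T}}) : rel T :=
  [rel x y | [set x; y] \in F].

Definition connected_rel (T : finType) (e : rel T) : bool :=
  [forall x : T, forall y : T, connect e x y].

(* A simple cycle visits at most #|T| vertices, so bounding its length loses
   nothing and keeps the predicate boolean. *)
Definition acyclic_rel (T : finType) (e : rel T) : bool :=
  [forall k : 'I_#|T|.+1, forall c : k.-tuple T,
     (2 < k) ==> ~~ ucycleb e c].

Definition spanning_tree (G : sgraph) (F : {set {set G}}) : bool :=
  [&& F \subset edge_set G, connected_rel (rel_of_edges F)
    & acyclic_rel (rel_of_edges F)].

Definition tau (G : sgraph) : nat := #|[set F | @spanning_tree G F]|.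

(* [None] is the hub, [Some i] the i-th rim vertex. *)
Definition wheel_rel (n : nat) : rel (option 'I_n) :=
  fun x y => match x, y with
             | None, Some _ => true
             | Some i, Some j => j == ordS i
             | _, _ => false
             end.

Definition wheel (n : nat) : sgraph := graph_of_rel (@wheel_rel n).

Section EdgePath.
Variables (m : nat) (G : sgraph).

(* One ordered pair per edge: [enum_rank] fixes a direction in which to number
   the internal vertices of the path replacing it. *)
Definition dir_edge : finType :=
  {p : G * G | adj p.1 p.2 && (enum_rank p.1 < enum_rank p.2)}.

Definition path_vert : finType := (G + dir_edge * 'I_m.-1)%type.

(* The k-th vertex, 0 <= k <= m, of the path replacing [d]. *)
Definition path_pt (d : dir_edge) (k : nat) : path_vert :=
  if k is k'.+1 then
    if insub k' is Some j then inr (d, j) else inl (val d).2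
  else inl (val d).1.

Definition path_rel : rel path_vert :=
  fun x y => [exists d : dir_edge, exists k : 'I_m,
                (x == path_pt d k) && (y == path_pt d k.+1)].

Definition edge_path : sgraph := graph_of_rel path_rel.
End EdgePath.

Section AttachCopies.
(* For each a : A, a new copy of H is attached to G by identifying the vertex
   [r a] of the copy with the vertex [f a] of G. *)
Variables (G : sgraph) (A : finType) (f : A -> G) (H : sgraph) (r : A -> H).

Definition copy_vert : finType := {p : A * H | p.2 != r p.1}.

Definition attach_vert : finType := (G + copy_vert)%type.

Definition copy_pt (a : A) (h : H) : attach_vert :=
  if insub (a, h) is Some p then inr p else inl (f a).

Definition attach_rel : rel attach_vert :=
  fun x y =>
    [exists u : G, exists v : G, [&& adj u v, x == inl u & y == inl v]]
    || [exists a : A, exists h : H, exists h' : H,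
          [&& adj h h', x == copy_pt a h & y == copy_pt a h']].

Definition attach_copies : sgraph := graph_of_rel attach_rel.
End AttachCopies.

Section WheelModel.
(* [rim G v] is the rim vertex of the new wheel that gets identified with v;
   the choice is arbitrary and may vary with the stage G and the vertex v. *)
Variables (m n : nat) (rim : forall G : sgraph, G -> 'I_n).

Definition wheel_step (G : sgraph) : sgraph :=
  @attach_copies (edge_path m G) G (fun v => inl v)
                 (wheel n) (fun v => Some (rim v)).

Definition wheel_model (i : nat) : sgraph := iter i wheel_step (wheel n).

(* |V^(k)| is the order of G^(k-1), with G^(-1) a single vertex. *)
Definition order_V (k : nat) : nat :=
  if k is k'.+1 then #|wheel_model k'| else 1.
End WheelModel.

Fixpoint lucas (k : nat) : nat :=
  match k with
  | 0 => 2
  | 1 => 1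
  | (k'.+1 as k1).+1 => lucas k1 + lucas k'
  end.

(* Main.v *)
Require Import Defs.
From mathcomp Require Import all_boot zify.

(** Spanning trees are the minimal connected edge sets, and connectedness is
    local for both constructions. An edge set of a graph with copies attached at
    single vertices is connected iff each of its parts is, so [tau] is
    multiplicative. An edge set of a subdivided graph is connected iff each path
    lacks at most one link and the paths without missing link form a connected
    edge set of [G]; since a spanning tree of [G] has [#|G|.-1] edges, subdivision
    multiplies [tau] by [m ^ (#|E| - #|G|.-1)].

    Orienting a spanning tree of the wheel towards the hub, every rim vertex
    points to the hub, to its successor or to its predecessor. The trees are the
    cyclic words over these three letters in which no "successor" is followed by a
    "predecessor", except for the two words that turn around the rim; a transfer
    matrix counts the cyclic words by the Lucas number [L_{2n}]. *)

Set Implicit Arguments.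
Unset Strict Implicit.
Unset Printing Implicit Defensive.

(** * Reachability and inclusion-minimal sets *)

Lemma set2_eq (T : finType) (x y a b : T) :
  [set x; y] = [set a; b] -> (x = a /\ y = b) \/ (x = b /\ y = a).
Proof.
move=> eq_xy_ab.
have : x \in [set a; b] by rewrite -eq_xy_ab set21.
have : y \in [set a; b] by rewrite -eq_xy_ab set22.
have : a \in [set x; y] by rewrite eq_xy_ab set21.
have : b \in [set x; y] by rewrite eq_xy_ab set22.
by rewrite !inE => /orP[]/eqP ? /orP[]/eqP ? /orP[]/eqP ? /orP[]/eqP ?; subst; auto.
Qed.

Lemma connect_morph (T U : finType) (e : rel T) (e' : rel U) (phi : T -> U) :
    (forall x y, e x y -> connect e' (phi x) (phi y)) ->
  forall x y, connect e x y -> connect e' (phi x) (phi y).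
Proof.
move=> phi_e x y /connectP[p]; elim: p x => [|z p IHp] x /=; first by move=> _ ->.
by case/andP=> exz ezp Dy; apply: connect_trans (phi_e _ _ exz) (IHp _ ezp Dy).
Qed.

Lemma connect_closed_pred (T : finType) (e : rel T) (P : pred T) :
    (forall x y, e x y -> P x -> P y) ->
  forall x y, connect e x y -> P x -> P y.
Proof.
move=> Pe x y /connectP[p]; elim: p x => [|z p IHp] x /=; first by move=> _ ->.
by case/andP=> exz ezp Dy Px; apply: (IHp z) => //; apply: Pe exz Px.
Qed.

(** Lets minimality of an edge set be tested on edge indices: every subset of [g @: F] is the image
    of its preimage under [g]. *)
Lemma minset_imset (E T : finType) (g : E -> T) (C : pred {set T}) (F : {set E}) :
  injective g -> minset C (g @: F) = minset (fun B : {set E} => C (g @: B)) F.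
Proof.
move=> inj_g; apply/minsetP/minsetP => -[CF minF]; split=> // B CB sBF.
  by apply: (imset_inj inj_g); rewrite /= (minF (g @: B)) ?imsetS.
have DB : B = g @: (g @^-1: B).
  apply/setP=> x; apply/idP/imsetP=> [xB | [y] /[!inE] ? -> //].
  by have /imsetP[y yF Dx] := subsetP sBF x xB; exists y; rewrite // inE -Dx.
rewrite DB (minF (g @^-1: B)) //= -?DB //.
by apply/subsetP=> y /[!inE] /(subsetP sBF); rewrite mem_imset.
Qed.

(** * Spanning trees as minimal connected edge sets *)

Section Connectedness.
Variable T : finType.
Implicit Types (F B : {set {set T}}) (x y : T).

Definition connected_edges F := connected_rel (rel_of_edges F).

Lemma rel_of_edgesE F x y : rel_of_edges F x y = ([set x; y] \in F).
Proof. by []. Qed.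

Lemma rel_of_edges_sym F : symmetric (rel_of_edges F).
Proof. by move=> x y; rewrite /rel_of_edges /= setUC. Qed.

Lemma connect_edges_sym F : connect_sym (rel_of_edges F).
Proof. exact/sym_connect_sym/rel_of_edges_sym. Qed.

Lemma connected_edgesP F :
  reflect (forall x y, connect (rel_of_edges F) x y) (connected_edges F).
Proof. by apply: (iffP forallP) => cF x; apply/forallP. Qed.

(** An edge whose ends stay joined without it is redundant, since each use of it in a path can be
    rerouted. *)
Lemma connected_edges_bypass F x y :
    connected_edges F -> connect (rel_of_edges (F :\ [set x; y])) x y ->
  connected_edges (F :\ [set x; y]).
Proof.
move=> /connected_edgesP cF cxy; apply/connected_edgesP => u v.
apply: (connect_morph (phi := id) _ (cF u v)) => a b /= abF.
have [Dab | nDab] := eqVneq [set a; b] [set x; y].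
  by have [[-> ->] | [-> ->]] := set2_eq Dab; rewrite // connect_edges_sym.
by apply: connect1; rewrite rel_of_edgesE !inE nDab.
Qed.

(** A step can be the removed edge only if both its ends lie on that edge. Hence it is enough that
    every vertex except the last avoids [x] and [y]; this suits a cycle that closes up at [x]. *)
Lemma path_avoiding_edge F x y z s :
    path (rel_of_edges F) z (rcons s x) -> all (fun a => a \notin [set x; y]) (z :: s) ->
  path (rel_of_edges (F :\ [set x; y])) z (rcons s x).
Proof.
have step a b : a \notin [set x; y] -> [set a; b] != [set x; y].
  by apply: contraNneq => <-; rewrite set21.
elim: s z => [|w s IHs] z; rewrite /= !rel_of_edgesE.
  by rewrite !andbT !in_setD1 => -> /step->.
by case/andP=> zwF sF /andP[zxy wxy]; rewrite IHs // andbT in_setD1 zwF step.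
Qed.

(** If a connected proper subset omits an edge, its path between the ends of that edge closes up to
    a cycle in [F]. Conversely, an edge on a cycle can be bypassed, so [F] is not minimal. *)
Lemma acyclic_minset F :
    connected_edges F -> (forall x, [set x; x] \notin F) ->
    (forall e, e \in F -> exists x y, e = [set x; y]) ->
  acyclic_rel (rel_of_edges F) = minset connected_edges F.
Proof.
move=> cF loopless pairF; apply/idP/minsetP => [acF | [_ minF]].
  split=> // B cB sBF; apply/eqP; rewrite eqEsubset sBF; apply/subsetP=> e eF.
  apply: contraLR (acF) => eB; have [x [y De]] := pairF e eF.
  have /connectP[p0 /shortenP[p pB Up _] Dy] := connected_edgesP _ cB x y.
  (* A path with one vertex would make [e] a loop, one with two vertices would put [e] in [B]. *)
  have p_gt1 : 2 < size (x :: p).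
    case: p pB Dy {Up} => [|z [|? ?]] //= pB Dy; first by have := loopless x; rewrite -{2}Dy -De eF.
    by move: pB; rewrite andbT rel_of_edgesE -Dy -De (negPf eB).
  have le_p : size (x :: p) < #|T|.+1 by rewrite ltnS -(card_uniqP Up) max_card.
  rewrite negb_forall; apply/existsP; exists (Ordinal le_p).
  rewrite negb_forall; apply/existsP; exists (in_tuple (x :: p)).
  rewrite negb_imply negbK [_ < _]p_gt1 /= /ucycleb Up andbT /= rcons_path -Dy.
  rewrite {2}/rel_of_edges /= setUC -De eF andbT.
  by apply: sub_path pB => a b /(subsetP sBF).
apply/forallP=> k; apply/forallP=> c; apply/implyP=> k_gt2.
apply/negP; case: c => c /= /eqP sz_c; rewrite /ucycleb.
case: c sz_c => [|x [|y [|z s]]] /= Dk; try by rewrite -Dk in k_gt2.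
case/andP=> /and3P[xyF yzF pF] /and4P[].
rewrite !inE !negb_or => /and3P[nxy nxz xs] /andP[nyz ys] zs _.
(* The rest of the cycle leads from [y] through [z] back to [x] without the edge [xy]. *)
have /minF : connected_edges (F :\ [set x; y]).
  apply: connected_edges_bypass => //; rewrite connect_edges_sym.
  apply/connectP; exists (z :: rcons s x); last by rewrite /= last_rcons.
  rewrite /= path_avoiding_edge ?andbT //=.
  - rewrite rel_of_edgesE in_setD1 [_ \in F]yzF andbT; apply: contraNneq nxz => /setP/(_ z).
    by rewrite !inE eqxx orbT (eq_sym z y) (negPf nyz) orbF eq_sym => <-.
  rewrite !inE (eq_sym z x) (eq_sym z y) negb_or nxz nyz /=.
  by apply/allP => a sa; rewrite !inE negb_or (memPn xs) ?(memPn ys).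
by move/(_ (subsetDl _ _))/setP/(_ [set x; y]); rewrite !inE eqxx [_ \in F]xyF.
Qed.

End Connectedness.

Lemma adj_edge_set (G : sgraph) (x y : G) : ([set x; y] \in edge_set G) = adj x y.
Proof.
rewrite inE; apply/existsP/idP => [[a /existsP[b /andP[ab /eqP/set2_eq[[-> ->]|[-> ->]]]]] | xy] //.
  by rewrite adj_sym.
by exists x; apply/existsP; exists y; rewrite xy /=.
Qed.

Lemma spanning_tree_minset (G : sgraph) (F : {set {set G}}) :
  spanning_tree F = (F \subset edge_set G) && minset (@connected_edges G) F.
Proof.
rewrite /spanning_tree -/(connected_edges F); have [sF /=|//] := boolP (F \subset _).
have [cF /=|ncF /=] := boolP (connected_edges F); last first.
  by apply/esym/(contraNF _ ncF) => /minsetp.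
apply: acyclic_minset => // [x | e /(subsetP sF)].
  by apply/negP => /(subsetP sF); rewrite adj_edge_set adj_irr.
by rewrite inE => /existsP[x /existsP[y /andP[_ /eqP->]]]; exists x, y.
Qed.

(** * Spanning trees as parent functions towards a root *)

Section Arborescences.
Variables (T : finType) (r : T).
Implicit Types (p q : {ffun T -> T}) (F : {set {set T}}).

(** The root is made a fixed point so that a tree determines its parent function completely. *)
Definition arborescence p := (p r == r) && [forall v, fconnect p v r].

Definition parent_edges p : {set {set T}} := [set [set v; p v] | v in [set~ r]].

(** Induction on the number of iterations of [p] that lead from [v] to [r]. *)
Lemma arborescence_ind p (P : T -> Prop) :
    arborescence p -> P r -> (forall v, v != r -> P (p v) -> P v) ->
  forall v, P v.
Proof.
case/andP=> _ /forallP cp Pr IHp v; have := iter_findex (cp v).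
move: (findex p v r) => k; elim: k v => [v /= -> //|k IHk v]; rewrite iterSr => Dr.
by have [-> //|nvr] := eqVneq v r; apply: IHp => //; apply: IHk.
Qed.

Lemma parent_edge_in p v : v != r -> [set v; p v] \in parent_edges p.
Proof. by move=> nvr; apply/imsetP; exists v; rewrite ?inE. Qed.

Lemma parent_edges_connected p : arborescence p -> connected_edges (parent_edges p).
Proof.
move=> arb_p; have to_r v : connect (rel_of_edges (parent_edges p)) v r.
  move: v; apply: (arborescence_ind arb_p) => // v nvr; apply: connect_trans.
  by apply/connect1/parent_edge_in.
apply/connected_edgesP => x y; apply: connect_trans (to_r x) _.
by rewrite connect_edges_sym.
Qed.

(** Otherwise [v] and [p v] would form a set closed under [p] that misses the root. *)
Lemma arborescence_no_2cycle p v : arborescence p -> v != r -> p (p v) = v -> p v = r.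
Proof.
move=> arb_p nvr ppv; apply/eqP/contraT => npvr.
have: r \in pred2 v (p v).
  have /andP[_ /forallP/(_ v) cv] := arb_p.
  apply: (connect_closed_pred (P := pred2 v (p v)) _ cv); last by rewrite /= eqxx.
  by move=> x y /= /eqP<- /orP[]/eqP->; rewrite ?ppv eqxx ?orbT.
by rewrite !inE eq_sym (negPf nvr) eq_sym (negPf npvr).
Qed.

Lemma card_parent_edges p : arborescence p -> #|parent_edges p| = #|T|.-1.
Proof.
move=> arb_p; have /andP[/eqP pr _] := arb_p.
rewrite card_in_imset ?cardsC1 // => v w; rewrite !inE => nvr nwr /set2_eq[[] // | [Dv pvw]].
have := arborescence_no_2cycle arb_p nvr; rewrite pvw -Dv => /(_ erefl) Dw.
by rewrite Dw eqxx in nwr.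
Qed.

(** Induction from the root outwards. If the edge from [v] to [p v] were used by [q] in the other
    direction, then [q (p v) = v]; as [p] and [q] agree at [p v], this is a 2-cycle of [p]. *)
Lemma parent_edges_inj : {in arborescence &, injective parent_edges}.
Proof.
move=> p q arb_p arb_q Dpq; apply/ffunP=> v.
have /andP[/eqP pr _] := arb_p; have /andP[/eqP qr _] := arb_q.
move: v; apply: (arborescence_ind arb_p) => [|v nvr IHv]; first by rewrite pr qr.
have := parent_edge_in p nvr; rewrite Dpq => /imsetP[w]; rewrite !inE => nwr.
case/set2_eq=> [[<-] // | [Dv Dw]].
have := arborescence_no_2cycle arb_p nvr.
by rewrite IHv Dw -Dv => /(_ erefl) Dr; rewrite Dr eqxx in nwr.
Qed.

(* A breadth-first search tree: every vertex points to a neighbour strictly closer to r. *)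
Lemma connected_arborescence F :
  connected_edges F -> exists2 p, arborescence p & parent_edges p \subset F.
Proof.
move=> /connected_edgesP cF; pose e := rel_of_edges F.
pose reach v k := [exists t : k.-tuple T, path e v t && (last v t == r)].
have exr v : exists k, reach v k.
  have /connectP[t et Dr] := cF v r; exists (size t).
  by apply/existsP; exists (in_tuple t); rewrite /= et Dr eqxx.
pose d v := ex_minn (exr v).
have closer v : v != r -> exists w, e v w && (d w < d v).
  move=> nvr; rewrite {2}/d; case: ex_minnP => k /existsP[[[|w t] /= sz_t]].
    by rewrite (negPf nvr).
  case/andP=> /andP[evw ewt] lt _; exists w; rewrite evw /d.
  case: ex_minnP => j _ /(_ (size t)) le_j; rewrite -(eqP sz_t) /=; apply: le_j.
  by apply/existsP; exists (in_tuple t); rewrite /= ewt.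
pose p := [ffun v => if v == r then r else odflt r [pick w | e v w && (d w < d v)]].
have pP v : v != r -> e v (p v) && (d (p v) < d v).
  move=> nvr; rewrite ffunE (negPf nvr); case: pickP => //= none.
  by have [w] := closer v nvr; rewrite none.
exists p; last by apply/subsetP=> _ /imsetP[v /[!inE] nvr ->]; case/andP: (pP v nvr).
rewrite /arborescence {1}ffunE !eqxx; apply/forallP=> v.
have [k] := ubnP (d v); elim: k v => // k IHk v lt_dv.
have [-> //|nvr] := eqVneq v r; have /andP[_ lt_p] := pP v nvr.
by apply: connect_trans (fconnect1 _ _) (IHk _ _); apply: leq_trans lt_p _.
Qed.

(** Each connected set contains the edges of an arborescence, and all arborescences have equally
    many edges, so none of these edge sets properly contains another. *)
Lemma minset_connectedP F :
  reflect (exists2 p, arborescence p & F = parent_edges p) (minset (@connected_edges T) F).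
Proof.
apply: (iffP minsetP) => [[cF minF] | [p arb_p ->]].
  have [p arb_p sF] := connected_arborescence cF; exists p => //.
  by rewrite (minF _ (parent_edges_connected arb_p)).
split=> [|B cB sB]; first exact: parent_edges_connected.
have [q arb_q sqB] := connected_arborescence cB.
apply/eqP; rewrite eqEcard sB (leq_trans _ (subset_leq_card sqB)) //.
by rewrite !card_parent_edges.
Qed.

End Arborescences.

Lemma card_minset_connected (T : finType) (F : {set {set T}}) :
  T -> minset (@connected_edges T) F -> #|F| = #|T|.-1.
Proof. by move=> r /(minset_connectedP r)[p arb_p ->]; apply: card_parent_edges. Qed.

Lemma tau_arborescences (G : sgraph) (r : G) :
  tau G = #|[set p : {ffun G -> G} | arborescence r p
                 & [forall v in [set~ r], adj v (p v)]]|.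
Proof.
rewrite /tau -(card_in_imset (f := parent_edges r)); last first.
  by move=> p q /[!inE] /andP[arb_p _] /andP[arb_q _]; apply: parent_edges_inj.
apply: eq_card => F; rewrite !inE spanning_tree_minset.
apply/andP/imsetP=> [[sF /(minset_connectedP r)[p arb_p DF]] | [p]].
  exists p; rewrite // inE arb_p; apply/forall_inP => v; rewrite !inE => nvr.
  by rewrite -adj_edge_set (subsetP sF) // DF parent_edge_in.
rewrite inE => /andP[arb_p /forall_inP adj_p] ->; split; last first.
  by apply/(minset_connectedP r); exists p.
by apply/subsetP=> _ /imsetP[v vr ->]; rewrite adj_edge_set adj_p.
Qed.

(** * Graphs presented by an indexed family of edges *)

Section Presentations.

Definition edge_of (V E : finType) (s t : E -> V) (e : E) : {set V} := [set s e; t e].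

Definition econnected (V E : finType) (s t : E -> V) (F : {set E}) :=
  connected_edges (edge_of s t @: F).

Definition trees (V E : finType) (s t : E -> V) : {set {set E}} :=
  [set F | minset (econnected s t) F].

(** With edges indexed by [E], spanning trees become subsets of [E], and the index types of the two
    constructions are plain sums and products. *)
Record presents (G : sgraph) (E : finType) (s t : E -> G) : Prop := Presents {
  edge_of_inj : injective (edge_of s t);
  edge_setE : edge_set G = edge_of s t @: setT
}.

Variables (V E : finType) (s t : E -> V).
Implicit Types (F : {set E}).

Lemma edge_connect F e :
  e \in F -> connect (rel_of_edges (edge_of s t @: F)) (s e) (t e).
Proof. by move=> eF; apply/connect1/imsetP; exists e. Qed.

Lemma econnectedP F :
  reflect (forall x y, connect (rel_of_edges (edge_of s t @: F)) x y) (econnected s t F).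
Proof. exact: connected_edgesP. Qed.

(** Serves both for inclusions of a part into a graph and for contractions of a graph onto a part,
    where an edge may collapse to a vertex. *)
Lemma connect_edges_morph (U : finType) (R : rel U) (phi : V -> U) F :
    connect_sym R -> {in F, forall e, connect R (phi (s e)) (phi (t e))} ->
  forall x y, connect (rel_of_edges (edge_of s t @: F)) x y -> connect R (phi x) (phi y).
Proof.
move=> symR phiF; apply: connect_morph => x y /imsetP[e /phiF De].
by case/set2_eq=> [[-> ->] | [-> ->]]; rewrite // symR.
Qed.

Lemma card_tree F : V -> injective (edge_of s t) -> F \in trees s t -> #|F| = #|V|.-1.
Proof.
move=> r inj_e; rewrite inE -minset_imset // => /(card_minset_connected r) <-.
by rewrite card_imset.
Qed.

End Presentations.

Lemma presents_adj (G : sgraph) (E : finType) (s t : E -> G) e :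
  presents s t -> adj (s e) (t e).
Proof. by case=> _ De; rewrite -adj_edge_set De (imset_f (edge_of s t)) ?inE. Qed.

Lemma presents_neq (G : sgraph) (E : finType) (s t : E -> G) e :
  presents s t -> s e != t e.
Proof.
by move=> /(@presents_adj _ _ _ _ e); apply: contraTneq => ->; rewrite adj_irr.
Qed.

Lemma card_edge_set (G : sgraph) (E : finType) (s t : E -> G) :
  presents s t -> #|edge_set G| = #|E|.
Proof. by case=> inj_e ->; rewrite card_imset // cardsT. Qed.

Lemma tau_trees (G : sgraph) (E : finType) (s t : E -> G) :
  presents s t -> tau G = #|trees s t|.
Proof.
case=> inj_e Dedge; rewrite -(card_imset _ (imset_inj inj_e)).
apply: eq_card => F; rewrite !inE spanning_tree_minset Dedge.
apply/andP/imsetP=> [[sF minF] | [B /[!inE] minB ->]]; last first.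
  by rewrite minset_imset // imsetS.
have DF : F = edge_of s t @: (edge_of s t @^-1: F).
  apply/setP=> x; apply/idP/imsetP=> [xF | [y] /[!inE] ? -> //].
  by have /imsetP[y yF Dx] := subsetP sF x xF; exists y; rewrite // inE -Dx.
by exists (edge_of s t @^-1: F); rewrite // inE -minset_imset -?DF.
Qed.

Lemma presents_graph_of_rel (T : finType) (R : rel T) (E : finType)
    (s t : E -> graph_of_rel R) :
    injective (edge_of s t) -> (forall e, s e != t e) ->
    (forall e, R (s e) (t e) || R (t e) (s e)) ->
    (forall x y, x != y -> R x y -> exists e, [set x; y] = edge_of s t e) ->
  presents s t.
Proof.
move=> inj_e neq_e R_e e_R; split=> //; apply/setP=> A; apply/idP/imsetP.
  rewrite inE => /existsP[x /existsP[y /andP[/andP[nxy /orP[]xy] /eqP->]]].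
    by have [e ->] := e_R x y nxy xy; exists e.
  by rewrite eq_sym in nxy; rewrite setUC; have [e ->] := e_R y x nxy xy; exists e.
by case=> e _ ->; rewrite adj_edge_set /= /symm_rel /= neq_e R_e.
Qed.

(** * Minimal sets in a disjoint union *)

Section GluedSets.
Variables (E1 E2 A : finType).
Implicit Types (X : {set E1}) (g : {ffun A -> {set E2}}).

Definition glue (Xg : {set E1} * {ffun A -> {set E2}}) : {set E1 + A * E2} :=
  [set e | match e with inl e1 => e1 \in Xg.1 | inr (a, e2) => e2 \in Xg.2 a end].

Definition unglue (F : {set E1 + A * E2}) : {set E1} * {ffun A -> {set E2}} :=
  ([set e | inl e \in F], [ffun a => [set e | inr (a, e) \in F]]).

Lemma glueK : cancel glue unglue.
Proof.
case=> X g; congr (_, _); first by apply/setP=> e; rewrite !inE.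
by apply/ffunP=> a; rewrite ffunE; apply/setP=> e; rewrite !inE.
Qed.

Lemma unglueK : cancel unglue glue.
Proof. by move=> F; apply/setP=> -[e|[a e]]; rewrite !inE ?ffunE ?inE. Qed.

Lemma glue_subset X g X' g' :
  (glue (X, g) \subset glue (X', g')) =
  (X \subset X') && [forall a, g a \subset g' a].
Proof.
apply/subsetP/andP=> [s | [/subsetP sX /forallP sg]]; last first.
  by case=> [e|[a e]]; rewrite !inE; [apply: sX | apply: (subsetP (sg a))].
split; first by apply/subsetP=> e; have := s (inl e); rewrite !inE.
by apply/forallP=> a; apply/subsetP=> e; have := s (inr (a, e)); rewrite !inE.
Qed.

Variables (C : pred {set E1 + A * E2}) (C1 : pred {set E1}) (C2 : pred {set E2}).
Hypothesis C_glue : forall X g, C (glue (X, g)) = C1 X && [forall a, C2 (g a)].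

(** Inclusion and [C] are both componentwise, so minimality is too: shrinking one component and
    keeping the others already gives a smaller set. *)
Lemma minset_glue X g :
  minset C (glue (X, g)) = minset C1 X && [forall a, minset C2 (g a)].
Proof.
apply/minsetP/andP => [[] | [/minsetP[C1X minX] /forallP ming]]; last first.
  split=> [|B CB].
    by rewrite C_glue C1X; apply/forallP=> a; have /minsetP[] := ming a.
  move: CB; rewrite -(unglueK B); case: (unglue B) => X' g'.
  rewrite C_glue glue_subset => /andP[C1X' /forallP C2g'] /andP[sX /forallP sg].
  congr (glue (_, _)); first exact: minX.
  by apply/ffunP=> a; have /minsetP[_ ming_a] := ming a; apply: ming_a.
rewrite C_glue => /andP[C1X /forallP C2g] minXg; split.
  apply/minsetP; split=> // X' C1X' sX.
  have /(can_inj glueK)[] // : glue (X', g) = glue (X, g).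
  apply: minXg; first by rewrite C_glue C1X'; apply/forallP.
  by rewrite glue_subset sX; apply/forallP.
apply/forallP=> a; apply/minsetP; split=> // Y C2Y sY.
pose g' := [ffun b => if b == a then Y else g b].
have /(can_inj glueK)[/ffunP/(_ a)] : glue (X, g') = glue (X, g); last by rewrite ffunE eqxx.
apply: minXg; first by rewrite C_glue C1X; apply/forallP=> b; rewrite ffunE; case: eqP.
by rewrite glue_subset subxx; apply/forallP=> b; rewrite ffunE; case: eqP => [->|].
Qed.

Lemma card_minset_glue :
  #|[set F | minset C F]| = #|[set X | minset C1 X]| * #|[set Y | minset C2 Y]| ^ #|A|.
Proof.
rewrite -card_ffun_on -[#|ffun_on _|]cardsE -cardsX -(card_imset _ (can_inj glueK)).
apply: eq_card => F; rewrite inE -{1}(unglueK F).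
rewrite -{2}(unglueK F) (mem_imset _ _ (can_inj glueK)).
case: (unglue F) => X g; rewrite minset_glue !inE; congr (_ && _).
by apply/forallP/forallP => /= h a; have := h a; rewrite !inE.
Qed.

End GluedSets.

(** * Attaching copies at single vertices *)

Section AttachCopies.
Variables (G : sgraph) (A : finType) (f : A -> G) (H : sgraph) (r : A -> H).
Variables (EG : finType) (sG tG : EG -> G) (EH : finType) (sH tH : EH -> H).
Hypotheses (presG : presents sG tG) (presH : presents sH tH).

Local Notation AG := (attach_copies f r).
Local Notation cpt := (copy_pt f r).

Definition attach_end (uG : EG -> G) (uH : EH -> H) (e : EG + A * EH) : AG :=
  match e with inl e => inl (uG e) | inr (a, e) => cpt a (uH e) end.

Local Notation sA := (attach_end sG sH).
Local Notation tA := (attach_end tG tH).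

(** [to_base] and [to_copy a] are retractions onto the parts: everything outside a part collapses to
    the vertex where it is attached. *)
Definition to_base (x : AG) : G :=
  match x with inl u => u | inr p => f (val p).1 end.

Definition to_copy (a : A) (x : AG) : H :=
  match x with inl u => r a | inr p => if (val p).1 == a then (val p).2 else r a end.

Lemma to_base_copy_pt a h : to_base (cpt a h) = f a.
Proof. by rewrite /copy_pt; case: insubP => [p _ /= ->|]. Qed.

Lemma to_copy_copy_pt a b h : to_copy a (cpt b h) = if b == a then h else r a.
Proof.
rewrite /copy_pt; case: insubP => [p _ /= -> //|/=].
by rewrite negbK => /eqP->; case: eqP => [->|].
Qed.

Lemma copy_pt_root a : cpt a (r a) = inl (f a).
Proof. by rewrite /copy_pt insubF //= eqxx. Qed.

Lemma inr_copy_pt (p : copy_vert r) : inr p = cpt (val p).1 (val p).2.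
Proof.
rewrite /copy_pt; case: insubP => [q _ Dq | /=]; last by rewrite (valP p).
by congr inr; apply: val_inj; rewrite Dq -surjective_pairing.
Qed.

Lemma attach_presents : presents sA tA.
Proof.
apply: presents_graph_of_rel.
(* The edges of copy [a] are exactly those that [to_copy a] does not collapse to a vertex. *)
- have split_inr a e e' : edge_of sA tA (inr (a, e)) = edge_of sA tA e' ->
      exists2 e2, e' = inr (a, e2) & edge_of sH tH e = edge_of sH tH e2.
    have nst := presents_neq e presH.
    case: e' => [e'|[b e']] /set2_eq /= Dst.
      by case: Dst nst => -[/(congr1 (to_copy a)) + /(congr1 (to_copy a))];
         rewrite !to_copy_copy_pt eqxx /= => -> ->; rewrite eqxx.
    have [Dab | nab] := eqVneq b a.
      exists e'; first by rewrite Dab.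
      by case: Dst => -[/(congr1 (to_copy a)) + /(congr1 (to_copy a))];
         rewrite !to_copy_copy_pt Dab eqxx /edge_of => -> ->; rewrite // setUC.
    by case: Dst nst => -[/(congr1 (to_copy a)) + /(congr1 (to_copy a))];
       rewrite !to_copy_copy_pt eqxx (negPf nab) => -> ->; rewrite eqxx.
  case=> [e|[a e]] e' Dee'; last first.
    by have [e2 -> /(edge_of_inj presH)->] := split_inr _ _ _ Dee'.
  case: e' Dee' => [e'|[a e']]; last by move/esym/split_inr=> [].
  case/set2_eq=> -[[De] [De']]; congr inl; apply: (edge_of_inj presG).
    by rewrite /edge_of De De'.
  by rewrite /edge_of De De' setUC.
- case=> [e|[a e]] /=; first by apply: contraNneq (presents_neq e presG) => -[->].
  apply: contraNneq (presents_neq e presH) => /(congr1 (to_copy a)).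
  by rewrite !to_copy_copy_pt eqxx => ->.
- case=> [e|[a e]] /=; apply/orP; left; apply/orP; [left | right].
    by apply/existsP; exists (sG e); apply/existsP; exists (tG e);
       rewrite (presents_adj e presG) !eqxx.
  by apply/existsP; exists a; apply/existsP; exists (sH e); apply/existsP; exists (tH e);
       rewrite (presents_adj e presH) !eqxx.
- move=> x y nxy /orP[/existsP[u /existsP[v /and3P[uv /eqP-> /eqP->]]] |].
    move: uv; rewrite -adj_edge_set (edge_setE presG) => /imsetP[e _ Duv].
    exists (inl e); rewrite /edge_of /=.
    by case/set2_eq: Duv => -[-> ->] //; rewrite setUC.
  case/existsP=> a /existsP[h /existsP[h' /and3P[hh' /eqP-> /eqP->]]].
  move: hh'; rewrite -adj_edge_set (edge_setE presH) => /imsetP[e _ Dhh'].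
  exists (inr (a, e)); rewrite /edge_of /=.
  by case/set2_eq: Dhh' => -[-> ->] //; rewrite setUC.
Qed.

(** The retractions send paths to paths in each part. Conversely, every vertex is joined inside its
    copy to the base, where all vertices are joined. *)
Lemma attach_econnected X g :
  econnected sA tA (glue (X, g)) = econnected sG tG X && [forall a, econnected sH tH (g a)].
Proof.
pose R := rel_of_edges (edge_of sA tA @: glue (X, g)).
have symR : connect_sym R by apply: connect_edges_sym.
apply/econnectedP/andP => [cR | [/econnectedP cX /forallP cg]].
  split; last (apply/forallP=> a); apply/econnectedP=> x y.
    have := connect_edges_morph (phi := to_base) _ _ (cR (inl x) (inl y)); apply.
      exact: connect_edges_sym.
    case=> [e|[a e]]; rewrite !inE /= => eX; first exact: edge_connect.
    by rewrite !to_base_copy_pt.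
  have := connect_edges_morph (phi := to_copy a) _ _ (cR (cpt a x) (cpt a y)).
  rewrite !to_copy_copy_pt eqxx; apply; first exact: connect_edges_sym.
  case=> [e|[b e]]; rewrite !inE //= => eX; rewrite !to_copy_copy_pt.
  by case: eqP eX => // -> /edge_connect.
have cGR x y : connect R (inl x) (inl y).
  apply: (connect_edges_morph (phi := inl) _ _ (cX x y)) => // e eX.
  by apply: (@edge_connect _ _ sA tA _ (inl e)); rewrite inE.
have cHR a x y : connect R (cpt a x) (cpt a y).
  have /econnectedP cga := cg a.
  apply: (connect_edges_morph (phi := cpt a) _ _ (cga x y)) => // e eX.
  by apply: (@edge_connect _ _ sA tA _ (inr (a, e))); rewrite inE.
have to_inl x : connect R x (inl (to_base x)).
  case: x => [x|p] //=; rewrite {1}inr_copy_pt -copy_pt_root; exact: cHR.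
move=> x y; apply: connect_trans (to_inl x) _; rewrite symR.
by apply: connect_trans (to_inl y) _.
Qed.

Lemma tau_attach : tau AG = tau G * tau H ^ #|A|.
Proof.
rewrite (tau_trees attach_presents) (tau_trees presG) (tau_trees presH).
exact: card_minset_glue attach_econnected.
Qed.

Lemma card_attach_edges : #|edge_set AG| = #|edge_set G| + #|A| * #|edge_set H|.
Proof.
rewrite (card_edge_set attach_presents) (card_edge_set presG) (card_edge_set presH).
by rewrite card_sum card_prod.
Qed.

Lemma card_attach_vert : #|AG| = #|G| + #|A| * #|H|.-1.
Proof.
rewrite card_sum card_sig; congr (_ + _).
rewrite (eq_card (B := [pred p : A * H | p.2 != r p.1])) // -sum1_card.
rewrite (eq_bigl (fun p : A * H => true && (p.2 != r p.1))) //.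
rewrite -(pair_big_dep xpredT (fun a h => h != r a) (fun _ _ => 1)) /=.
under eq_bigr => a _ do rewrite sum1_card cardC1.
by rewrite sum_nat_const.
Qed.

End AttachCopies.

(** * Edge sets with at most one missing link per path *)

(* [g e = Some k] records that the link [k] of the path replacing [e] is missing,
   [g e = None] that the path is complete. *)
Section CutSets.
Variables (E : finType) (m : nat).
Implicit Types (g : {ffun E -> option 'I_m}) (F : {set E * 'I_m}).

Definition cut_set g : {set E * 'I_m} := [set ek | g ek.1 != Some ek.2].

Definition uncut g : {set E} := [set e | g e == None].

Lemma cut_set_subset g g' :
  cut_set g \subset cut_set g' -> forall e k, g' e = Some k -> g e = Some k.
Proof.
move/subsetP=> s e k g'e; have := s (e, k); rewrite !inE g'e eqxx.
by case: eqP => // _ /(_ isT).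
Qed.

Lemma cut_set_inj : injective cut_set.
Proof.
move=> g g' Dgg'; apply/ffunP=> e.
have sgg' : cut_set g \subset cut_set g' by rewrite Dgg'.
have sg'g : cut_set g' \subset cut_set g by rewrite Dgg'.
case g'e : (g' e) => [k|]; first exact: cut_set_subset sgg' _ _ g'e.
by case ge : (g e) => [k|] //; have := cut_set_subset sg'g ge; rewrite g'e.
Qed.

(** The hypothesis says that each path misses at most one link, and [g] picks that link. *)
Lemma cut_set_codom F :
  (forall e (k k' : 'I_m), k < k' -> (e, k) \notin F -> (e, k') \in F) -> F \in codom cut_set.
Proof.
move=> missF; apply/codomP; exists [ffun e => [pick k | (e, k) \notin F]].
apply/setP=> -[e k]; rewrite inE ffunE /=; case: pickP => [k' ek' | /(_ k)/negbFE-> //].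
have [<- | nkk'] := eqVneq k' k; first by rewrite eqxx; apply/negbTE.
have -> : Some k' != Some k by apply: contraNneq nkk' => -[->].
by case: (ltngtP k k') nkk' => [lt|lt|/val_inj->]; rewrite ?eqxx // => _;
  [apply: contraNT ek' => /missF -> | apply: missF ek'].
Qed.

Lemma card_uncut (X : {set E}) : #|[set g | uncut g == X]| = m ^ #|~: X|.
Proof.
have cardS : #|predC1 (None : option 'I_m)| = m by rewrite cardC1 card_option card_ord.
rewrite -[m in RHS]cardS -(card_pffun_on None) -[RHS]cardsE; apply: eq_card => g; rewrite !inE.
apply/eqP/pffun_onP=> [<- | [/subsetP sg ng]].
  split=> [|_ /imageP[e /[!inE] eg ->] //].
  by apply/subsetP=> e; rewrite !inE.
apply/setP=> e; rewrite inE; apply/eqP/idP => [ge | eX].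
  by apply: contraT => eX; have /ng : g e \in [seq g x | x in ~: X];
    rewrite ?inE ?ge ?eqxx //; apply/imageP; exists e; rewrite // inE.
by apply: contraTeq eX => /sg; rewrite inE.
Qed.

Variables (C : pred {set E}) (C' : pred {set E * 'I_m}).
Hypothesis m_gt0 : 0 < m.
Hypothesis C'_cut : forall F, C' F -> F \in codom cut_set.
Hypothesis C'_uncut : forall g, C' (cut_set g) = C (uncut g).

(** By [cut_set_subset], a smaller cut set keeps the existing cuts and can only cut further paths,
    that is, shrink the set of uncut edges. *)
Lemma minset_cut_set g : minset C' (cut_set g) = minset C (uncut g).
Proof.
apply/minsetP/minsetP; rewrite C'_uncut => -[Cg ming]; split=> // B CB sB.
  (* Paths outside [B] are cut where [g] cuts them already, and otherwise at link 0. *)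
  pose g' := [ffun e => if e \in B then None else Some (odflt (Ordinal m_gt0) (g e))].
  have DB : uncut g' = B by apply/setP=> e; rewrite inE ffunE; case: ifP.
  rewrite -DB; congr (uncut _); apply: cut_set_inj; apply: ming.
    by rewrite C'_uncut DB.
  apply/subsetP=> -[e k]; rewrite !inE ffunE /=.
  by case: ifP => [/(subsetP sB)/[!inE]/eqP-> // | _]; case: (g e).
have /codomP[g' DB] := C'_cut CB; rewrite DB in CB sB *.
have sg := cut_set_subset sB; rewrite C'_uncut in CB.
have Dg : uncut g' = uncut g.
  apply: ming => //; apply/subsetP=> e; rewrite !inE.
  by case ge : (g e) => [k|] //; rewrite (sg _ _ ge).
congr cut_set; apply/ffunP=> e; case ge : (g e) => [k|]; first exact: sg.
by have /setP/(_ e) := Dg; rewrite !inE ge => /eqP.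
Qed.

(** The fibre of [uncut] over a minimal [X] consists of the choices of one link out of [m] for each
    of the [#|E| - c] edges outside [X]. *)
Lemma card_minset_cut c :
    (forall X, minset C X -> #|X| = c) ->
  #|[set F | minset C' F]| = #|[set X | minset C X]| * m ^ (#|E| - c).
Proof.
move=> cardX.
have -> : [set F | minset C' F] = cut_set @: [set g | minset C (uncut g)].
  apply/setP=> F; rewrite inE; apply/idP/imsetP=> [minF | [g /[!inE] ming ->]].
    have /codomP[g Dg] := C'_cut (minsetp minF).
    by exists g; rewrite // inE -minset_cut_set -Dg.
  by rewrite minset_cut_set.
rewrite card_imset; last exact: cut_set_inj.
rewrite -sum_nat_const -sum1_card (partition_big uncut (mem [set X | minset C X])) /=; last first.
  by move=> g; rewrite !inE.
apply: eq_bigr => X; rewrite inE => minX; rewrite -(cardX X minX) -(cardsC X) addKn -card_uncut.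
rewrite sum1dep_card; apply: eq_card => g; rewrite !inE.
by case: eqP => [->|]; rewrite ?minX ?andbF.
Qed.

End CutSets.

(** * Subdividing every edge *)

Section EdgePath.
Variables (m : nat) (G : sgraph).
Hypothesis m_gt1 : 1 < m.

Local Notation E := (dir_edge G).
Local Notation PG := (edge_path m G).
Local Notation pt := (@path_pt m G).

Local Arguments path_pt : simpl never.

Definition dir_src (d : E) : G := (val d).1.
Definition dir_tgt (d : E) : G := (val d).2.

Lemma dir_edge_presents : presents dir_src dir_tgt.
Proof.
have adj_d d : adj (dir_src d) (dir_tgt d) by case/andP: (valP d).
split.
  move=> d d' /set2_eq[[Ds Dt] | [Ds Dt]].
    by apply: val_inj; rewrite [LHS]surjective_pairing [RHS]surjective_pairing; congr (_, _).
  case/andP: (valP d) (valP d') => _ + /andP[_].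
  rewrite -[(val d).1]/(dir_src d) -[(val d).2]/(dir_tgt d) Ds Dt => lt1 lt2.
  by have := ltn_trans lt1 lt2; rewrite ltnn.
apply/setP=> A; rewrite inE; apply/existsP/imsetP; last first.
  by case=> d _ ->; exists (dir_src d); apply/existsP; exists (dir_tgt d); rewrite adj_d /=.
case=> x /existsP[y /andP[xy /eqP->]].
have [lt_xy | lt_yx | Dxy] := ltngtP (enum_rank x) (enum_rank y).
- have xyE : adj (x, y).1 (x, y).2 && (enum_rank (x, y).1 < enum_rank (x, y).2).
    by rewrite xy.
  by exists (Sub (x, y) xyE).
- have yxE : adj (y, x).1 (y, x).2 && (enum_rank (y, x).1 < enum_rank (y, x).2).
    by rewrite adj_sym xy.
  by exists (Sub (y, x) yxE); rewrite // setUC.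
by move/val_inj/enum_rank_inj: Dxy xy => ->; rewrite adj_irr.
Qed.

Definition link_src (dk : E * 'I_m) : PG := pt dk.1 dk.2.
Definition link_tgt (dk : E * 'I_m) : PG := pt dk.1 dk.2.+1.

(** The last case covers all positions from [m] on, since [path_pt] is defined for every natural
    number. *)
Variant path_pt_spec (d : E) : nat -> path_vert m G -> Type :=
  | PathPtSrc : path_pt_spec d 0 (inl (dir_src d))
  | PathPtIn (j : 'I_m.-1) : path_pt_spec d j.+1 (inr (d, j))
  | PathPtTgt k of m <= k : path_pt_spec d k (inl (dir_tgt d)).

Lemma path_ptP d k : path_pt_spec d k (pt d k).
Proof.
case: k => [|k]; first exact: PathPtSrc.
rewrite /path_pt; case: insubP => [j _ <- | ]; first exact: PathPtIn.
by rewrite -leqNgt => le_mk; apply: PathPtTgt; lia.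
Qed.

Lemma path_pt_last d : pt d m = inl (dir_tgt d).
Proof.
suff pt_tgt k : m <= k -> pt d k = inl (dir_tgt d) by apply: pt_tgt.
case: path_ptP => // [|j] le_mj; first by lia.
by have := ltn_ord j; lia.
Qed.

(** A left inverse of [path_pt d] on the positions 0 to [m], meant for vertices of the path [d]
    only. *)
Definition path_pos (d : E) (x : PG) : nat :=
  match x with
  | inl v => if v == dir_src d then 0 else m
  | inr (_, j) => j.+1
  end.

Lemma path_posK d k : k <= m -> path_pos d (pt d k) = k.
Proof.
move=> le_km; case: path_ptP le_km => /= [|j|k' le_mk le_km] //; first by rewrite eqxx.
have := presents_neq d dir_edge_presents; rewrite eq_sym => /negPf->.
by apply/eqP; rewrite eqn_leq le_mk.
Qed.

Lemma path_pt_inner d d' k q : pt d k = inr (d', q) -> d = d'.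
Proof. by case: path_ptP => // j [->]. Qed.

Lemma path_pt_in d j (lt_jm : j < m.-1) : pt d j.+1 = inr (d, Ordinal lt_jm).
Proof. by rewrite /path_pt insubT. Qed.

(** As [m > 1], each link has an internal vertex among its ends, which identifies the path it
    belongs to. *)
Lemma link_inner d (k : 'I_m) : exists q, pt d k = inr (d, q) \/ pt d k.+1 = inr (d, q).
Proof.
case: k => -[|k] /= lt_km.
  have lt0 : 0 < m.-1 by lia.
  by exists (Ordinal lt0); right; apply: path_pt_in.
have lt_k : k < m.-1 by lia.
by exists (Ordinal lt_k); left; apply: path_pt_in.
Qed.

Lemma edge_path_presents : presents link_src link_tgt.
Proof.
apply: presents_graph_of_rel.
- case=> [d k] [d' k'] /set2_eq; rewrite /link_src /link_tgt /= => Dlink.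
  have Dd : d = d'.
    have [q [Dq|Dq]] := link_inner d k; apply/esym; case: Dlink => -[Ds Dt].
    - by move: Dq; rewrite Ds; apply: path_pt_inner.
    - by move: Dq; rewrite Ds; apply: path_pt_inner.
    - by move: Dq; rewrite Dt; apply: path_pt_inner.
    - by move: Dq; rewrite Dt; apply: path_pt_inner.
  rewrite {}Dd in Dlink *; congr (_, _); apply: val_inj => /=.
  have := (ltn_ord k, ltn_ord k').
  by case: Dlink => -[/(congr1 (path_pos d')) + /(congr1 (path_pos d'))];
     rewrite !path_posK ?(ltnW (ltn_ord _)) //; lia.
- case=> d k; apply/eqP=> /(congr1 (path_pos d)).
  by rewrite !path_posK ?(ltnW (ltn_ord _)) //=; lia.
- case=> d k; apply/orP; left.
  by apply/existsP; exists d; apply/existsP; exists k; rewrite !eqxx.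
- move=> x y _ /existsP[d /existsP[k /andP[/eqP-> /eqP->]]].
  by exists (d, k).
Qed.

(** Two missing links on one path would cut off the segment between them. *)
Lemma edge_path_connected_cut (F : {set E * 'I_m}) :
  econnected link_src link_tgt F -> F \in codom (@cut_set E m).
Proof.
move=> /econnectedP cF; apply: cut_set_codom => d k k' lt_kk' nk; apply: contraT => nk'.
(* The internal vertex [j] has position [j.+1], so [P] describes the positions [k.+1] to [k'] of the
   path [d]. *)
pose P (x : PG) := if x is inr (d', j) then (d' == d) && (k <= j < k') else false.
have Ppt d' j : P (pt d' j) = (d' == d) && (k < j <= k').
  case: path_ptP => [|q|j' le_mj] //=; first by rewrite andbF.
  have := ltn_ord k'; case: (d' == d) => //=; lia.
suff /(_ _ _ (cF (pt d k.+1) (inl (dir_src d)))) :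
    forall x y, connect (rel_of_edges (edge_of link_src link_tgt @: F)) x y -> P x -> P y.
  by rewrite Ppt eqxx ltnSn lt_kk' => /(_ isT).
apply: connect_closed_pred => x y /imsetP[[d' q] qF /set2_eq Dxy].
have nqk : d' = d -> (q != k :> nat) && (q != k' :> nat).
  move=> Dd; rewrite Dd in qF; apply/andP.
  by split; [apply: contraNneq nk | apply: contraNneq nk'] => /val_inj <-.
by case: Dxy => -[-> ->]; rewrite /link_src /link_tgt !Ppt; case: (d' =P d) => //= Dd;
   have := nqk Dd; lia.
Qed.

Lemma edge_path_econnected (g : {ffun E -> option 'I_m}) :
  econnected link_src link_tgt (cut_set g) = econnected dir_src dir_tgt (uncut g).
Proof.
pose R := rel_of_edges (edge_of link_src link_tgt @: cut_set g).
have symR : connect_sym R by apply: connect_edges_sym.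
(* The link at which the path is broken; for an uncut path the last link is taken. *)
pose c d : nat := if g d is Some k then k else m.-1.
have c_lt d : c d < m by rewrite /c; case: (g d) => [k|]; [apply: ltn_ord | lia].
apply/econnectedP/econnectedP => [cR x y | cG].
  (* Each path is contracted to its two ends by breaking it at link [c d]. Only this link is not
     collapsed, and if it is present then [d] is uncut, so it maps to an available edge. *)
  pose phi (x : PG) : G :=
    match x with inl v => v | inr (d, j) => if j < c d then dir_src d else dir_tgt d end.
  have phi_pt d j : phi (pt d j) = if j <= c d then dir_src d else dir_tgt d.
    case: path_ptP => [|q|j' le_mj] //=; rewrite leqNgt ifF //.
    by apply/negbTE; rewrite negbK (leq_trans (c_lt d)).
  have := connect_edges_morph (phi := phi) _ _ (cR (inl x) (inl y)); apply.
    exact: connect_edges_sym.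
  case=> d k; rewrite inE /= /link_src /link_tgt /= !phi_pt => gdk.
  case: (ltngtP k (c d)) => // Dk; apply: edge_connect; rewrite inE.
  by move: gdk Dk; rewrite /c; case: (g d) => [k'|] // nk Dk; rewrite (val_inj Dk) eqxx in nk.
have seg d a b : a <= b <= m -> (forall i : 'I_m, a <= i < b -> g d != Some i) ->
    connect R (pt d a) (pt d b).
  elim: b => [|b IHb] /andP[]; first by rewrite leqn0 => /eqP->.
  rewrite leq_eqVlt => /predU1P[-> //| le_ab] lt_bm ng.
  apply: connect_trans (IHb _ _) _; first by lia.
    by move=> i lt_i; apply: ng; lia.
  by apply: (@edge_connect _ _ link_src link_tgt _ (d, Ordinal lt_bm)); rewrite inE ng //=; lia.
have cGR x y : connect R (inl x) (inl y).
  apply: (connect_edges_morph (phi := inl) _ _ (cG x y)) => // d; rewrite inE => /eqP gd.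
  by rewrite -path_pt_last; apply: (seg d 0 m) => [|i _]; rewrite ?leqnn ?gd.
(* An internal vertex is joined to the end of its path that lies on its side of the break. *)
have to_inl x : exists v, connect R x (inl v).
  case: x => [v|[d j]]; first by exists v.
  have lt_jm : j < m.-1 by [].
  have -> : inr (d, j) = pt d j.+1 by rewrite path_pt_in; congr (inr (_, _)); apply: val_inj.
  have [le_jc | lt_cj] := leqP j.+1 (c d).
    exists (dir_src d); rewrite symR; apply: (seg d 0) => [|i lt_ij]; first by lia.
    have lt_ic : i < c d by lia.
    by apply: contraTneq lt_ic => gd; rewrite /c gd ltnn.
  exists (dir_tgt d); rewrite -path_pt_last; apply: seg => [|i /andP[lt_ji _]]; first by lia.
  have lt_ci : c d < i by lia.
  by apply: contraTneq lt_ci => gd; rewrite /c gd ltnn.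
move=> x y; have [u xu] := to_inl x; have [v yv] := to_inl y.
apply: connect_trans xu _; rewrite symR; exact: connect_trans yv _.
Qed.

Lemma card_edge_path_edges : #|edge_set PG| = #|edge_set G| * m.
Proof.
by rewrite (card_edge_set edge_path_presents) (card_edge_set dir_edge_presents) card_prod card_ord.
Qed.

Lemma card_edge_path_vert : #|PG| = #|G| + #|edge_set G| * m.-1.
Proof. by rewrite (card_edge_set dir_edge_presents) card_sum card_prod card_ord. Qed.

Lemma tau_edge_path : G -> tau PG = tau G * m ^ (#|edge_set G| - #|G|.-1).
Proof.
move=> r; rewrite (tau_trees edge_path_presents) (tau_trees dir_edge_presents).
rewrite (card_edge_set dir_edge_presents); apply: card_minset_cut.
- exact: ltnW.
- exact: edge_path_connected_cut.
- exact: edge_path_econnected.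
by move=> X minX; apply: (card_tree r (edge_of_inj dir_edge_presents)); rewrite inE.
Qed.

End EdgePath.

(** * Cyclic words and Lucas numbers *)

Fixpoint fib (k : nat) : nat :=
  match k with
  | 0 => 0
  | 1 => 1
  | (k'.+1 as k1).+1 => fib k1 + fib k'
  end.

Arguments fib : simpl never.

Lemma fibS k : fib k.+2 = fib k.+1 + fib k. Proof. by []. Qed.

Lemma lucas_fib k : lucas k.+1 = fib k.+2 + fib k.
Proof.
elim/ltn_ind: k => -[|[|k]] IHk //.
have -> : lucas k.+3 = lucas k.+2 + lucas k.+1 by [].
rewrite !IHk // (fibS k.+2) (fibS k); lia.
Qed.

(* A letter orients a rim vertex i of the wheel towards the hub (None), towards
   ordS i (Some true) or towards ord_pred i (Some false). *)
Definition letter := option bool.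

(** The excluded pair is a rim vertex and its successor pointing at each other, a 2-cycle that
    misses the hub. *)
Definition compatible : rel letter :=
  fun x y => ~~ ((x == Some true) && (y == Some false)).

Lemma big_letter (F : letter -> nat) :
  \sum_x F x = F None + F (Some true) + F (Some false).
Proof.
rewrite (bigD1 None) // (bigD1 (Some true)) // (bigD1 (Some false)) //= big1 ?addn0 ?addnA //.
by case=> [[]|].
Qed.

Lemma big_tuple_cons (T : finType) k (F : k.+1.-tuple T -> nat) :
  \sum_(t : k.+1.-tuple T) F t = \sum_x \sum_(s : k.-tuple T) F (cons_tuple x s).
Proof.
rewrite pair_big /= (reindex (fun xs : T * k.-tuple T => cons_tuple xs.1 xs.2)) //=.
apply: onW_bij; exists (fun t => (thead t, behead_tuple t)) => [[x s]|t].
  by rewrite theadE; congr (_, _); apply: val_inj.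
by apply: val_inj; rewrite /= [in RHS](tuple_eta t).
Qed.

(** The entry at [(x, y)] of the power [k.+1] of the transfer matrix of [compatible]. *)
Definition walks k (x y : letter) : nat :=
  \sum_(s : k.-tuple letter) path compatible x (rcons s y).

Lemma walksS k x y : walks k.+1 x y = \sum_z compatible x z * walks k z y.
Proof.
rewrite /walks big_tuple_cons; apply: eq_bigr => z _.
by rewrite big_distrr /=; apply: eq_bigr => s _; rewrite mulnb.
Qed.

(** Compatibility only tests whether the left letter is [Some true] and whether the right one is
    [Some false]; each of these restrictions lowers the Fibonacci index by one. *)
Lemma walks_fib k x y :
  walks k x y = fib (k.*2.+2 - (x == Some true) - (y == Some false)).
Proof.
elim: k x y => [|k IHk] x y.
  rewrite /walks (big_pred1 [tuple]) => [|t]; last by rewrite [t]tuple0 /= eqxx.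
  by case: x y => [[]|] [[]|].
rewrite walksS big_letter !IHk doubleS.
by case: x y => [[]|] [[]|]; rewrite /= ?subSS ?subn0 ?mul1n ?mul0n ?fibS; lia.
Qed.

Lemma card_cyclic_tuples k :
  #|[set t : k.+1.-tuple letter | cycle compatible t]| = lucas k.+1.*2.
Proof.
rewrite -sum1dep_card big_mkcond big_tuple_cons.
(* The trace of the matrix power: a cyclic word is a closed walk from its first letter. *)
transitivity (\sum_x walks k x x).
  by apply: eq_bigr => x _; apply: eq_bigr => s _ /=; case: path.
rewrite big_letter !walks_fib doubleS lucas_fib /= ?subSS ?subn0 ?fibS; lia.
Qed.

Lemma cycle_tnth (T : Type) (e : rel T) k (t : k.+1.-tuple T) :
  cycle e t = [forall i, e (tnth t i) (tnth t (ordS i))].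
Proof.
case: t => -[|x s] sz_s //=; have Dk : size s = k by case/eqP: sz_s.
apply/(pathP x)/forallP => [es i | es i]; last first.
  rewrite size_rcons Dk => lt_ik; have := es (Ordinal lt_ik).
  rewrite !(tnth_nth x) /= -rcons_cons !nth_rcons /= Dk lt_ik.
  move: (lt_ik); rewrite ltnS leq_eqVlt => /predU1P[->|lt_i].
    by rewrite modnn ltnn eqxx.
  by rewrite modn_small ?ltnS // lt_i.
have := es i; rewrite size_rcons Dk ltn_ord => /(_ isT).
rewrite !(tnth_nth x) /= -rcons_cons !nth_rcons /= Dk ltn_ord.
have := ltn_ord i; rewrite ltnS leq_eqVlt => /predU1P[->|lt_i].
  by rewrite modnn ltnn eqxx.
by rewrite modn_small ?ltnS // lt_i.
Qed.

Lemma ordS_closed n (P : pred 'I_n) i :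
  P i -> (forall j, P j -> P (ordS j)) -> forall j, P j.
Proof.
move=> Pi PS j; have val_iter k : iter k (@ordS n) i = (i + k) %% n :> nat.
  elim: k => [|k IHk]; first by rewrite addn0 modn_small.
  by rewrite /= IHk -addn1 modnDml addn1 addnS.
(* From [i], [n - i] steps lead to 0 and [j] further steps lead to [j]. *)
have -> : j = iter (n - i + j) (@ordS n) i.
  apply: val_inj; rewrite /= val_iter addnA subnKC 1?ltnW // modnDl.
  by rewrite modn_small.
by elim: (_ + _) => //= k; apply: PS.
Qed.

(** The complement of [P] is closed under [ordS], so a single failure of [P] would spread to [i]. *)
Lemma ord_pred_closed n (P : pred 'I_n) i :
  P i -> (forall j, P j -> P (ord_pred j)) -> forall j, P j.
Proof.
move=> Pi PP j; apply: contraT => nPj.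
have := ordS_closed (P := [pred k | ~~ P k]) nPj _ i; rewrite /= Pi; apply => k.
by apply: contra => /PP; rewrite ordSK.
Qed.

(** * Spanning trees of the wheel *)

Section WheelTrees.
Variable n : nat.
Hypothesis n_gt2 : 2 < n.
Implicit Types (w : {ffun 'I_n -> letter}) (i j : 'I_n).

Lemma ordS_neq i : ordS i != i.
Proof.
rewrite -val_eqE /=; have := ltn_ord i; rewrite leq_eqVlt => /predU1P[Di|lt_i].
  by rewrite Di modnn; lia.
by rewrite modn_small //; lia.
Qed.

(** For [n > 2] the successor and the predecessor of a rim vertex differ; this keeps the rim edges
    distinct and the letters distinguishable. *)
Lemma ordS2_neq i : ordS (ordS i) != i.
Proof.
rewrite -val_eqE /= -addn1 modnDml addn1; have := ltn_ord i.
have [Di|[Di|lt_i]] : i.+2 = n \/ (i.+2 = n.+1 \/ i.+2 < n) by have := ltn_ord i; lia.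
- by rewrite Di modnn; lia.
- by rewrite Di -(addn1 n) modnDl modn_small; lia.
by rewrite modn_small //; lia.
Qed.

Definition wheel_src (e : 'I_n + 'I_n) : wheel n :=
  match e with inl i => Some i | inr i => None end.
Definition wheel_tgt (e : 'I_n + 'I_n) : wheel n :=
  match e with inl i => Some (ordS i) | inr i => Some i end.

Lemma wheel_presents : presents wheel_src wheel_tgt.
Proof.
apply: presents_graph_of_rel.
- case=> [i|i] [j|j] /set2_eq[] [] //= => [[->] _ | [Di] [Dj] | _ [->]] //.
  by have := ordS2_neq i; rewrite Dj -Di eqxx.
- by case=> [i|i] //=; apply: contraNneq (ordS_neq i) => -[<-].
- by case=> [i|i]; rewrite /= ?eqxx.
case=> [i|] [j|] //= _; last by exists (inr j).
by move/eqP->; exists (inl i).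
Qed.

Lemma card_wheel : #|wheel n| = n.+1.
Proof. by rewrite card_option card_ord. Qed.

Lemma card_wheel_edges : #|edge_set (wheel n)| = n.*2.
Proof. by rewrite (card_edge_set wheel_presents) card_sum card_ord addnn. Qed.

Definition turn (x : letter) i : option 'I_n :=
  match x with
  | None => None
  | Some true => Some (ordS i)
  | Some false => Some (ord_pred i)
  end.

Definition word_parent w : {ffun wheel n -> wheel n} :=
  [ffun v => if v is Some i then turn (w i) i else None].

Definition cyclic_words : {set {ffun 'I_n -> letter}} :=
  [set w : {ffun 'I_n -> letter} | [forall i, compatible (w i) (w (ordS i))]].

Definition wheel_words :=
  cyclic_words :\: [set [ffun=> Some true]; [ffun=> Some false]].

Lemma turn_inj i : injective (turn^~ i).
Proof.
have neq : ordS i != ord_pred i.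
  by apply: contraNneq (ordS2_neq i) => ->; rewrite ord_predK.
by move=> [[]|] [[]|] //= /(congr1 (odflt i)) /= D; move: neq; rewrite D eqxx.
Qed.

Lemma word_parent_inj : injective word_parent.
Proof.
move=> w w' /ffunP Dw; apply/ffunP=> i; apply: (@turn_inj i).
by have := Dw (Some i); rewrite !ffunE.
Qed.

(** A nonempty set closed under [p] without the hub excludes an arborescence: the whole rim for a
    constant word of turns, two facing vertices for an incompatible pair. Conversely, a rim vertex
    that never reaches the hub forces its letter on the whole rim. *)
Lemma word_parent_arborescence w :
  arborescence None (word_parent w) = (w \in wheel_words).
Proof.
set p := word_parent w.
have pS i : p (Some i) = turn (w i) i by rewrite ffunE.
have pN : p None = None by rewrite ffunE.
have trapped (P : pred (wheel n)) v : P v -> ~~ P None -> (forall u, P u -> P (p u)) ->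
    ~~ arborescence None p.
  move=> Pv nPN Pp; apply: contra nPN => /andP[_ /forallP/(_ v) cv].
  by apply: (connect_closed_pred (P := P) _ cv) => // x y /eqP<-; apply: Pp.
have all_const b : (forall i, w i = Some b) -> w = [ffun=> Some b].
  by move=> wb; apply/ffunP=> i; rewrite ffunE.
have [i0 _] : exists i : 'I_n, true by exists (Ordinal (ltnW (ltnW n_gt2))).
apply/idP/idP => [arb_p | ].
  rewrite !inE; apply/andP; split.
    apply/negP=> /orP[]/eqP Dw; move: arb_p; apply/negP;
      apply: (trapped (fun v => v != None) (Some i0)) => // -[i|] // _;
      by rewrite pS Dw ffunE.
  apply/forallP=> i; apply/negP=> /andP[/eqP wi /eqP wSi].
  move: arb_p; apply/negP; apply: (trapped (pred2 (Some i) (Some (ordS i))) (Some i)) => //=.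
    by rewrite eqxx.
  by move=> _ /orP[]/eqP->; rewrite pS ?wi ?wSi /= ?ordSK eqxx ?orbT.
rewrite !inE => /andP[/norP[nR nL] /forallP ok].
rewrite /arborescence pN eqxx; apply/forallP=> -[i|]; last by [].
apply: contraT => nci.
have next j : ~~ fconnect p (Some j) None -> ~~ fconnect p (turn (w j) j) None.
  by apply: contra => cj; apply: connect_trans cj; rewrite -pS fconnect1.
(* Being stuck with letter [b] passes to the next vertex in direction [b]: its letter cannot be
   [None], which leads to the hub, nor the opposite turn, by compatibility. *)
pose stuck b j := (w j == Some b) && ~~ fconnect p (Some j) None.
case wi : (w i) (next i nci) => [[]|] /=; rewrite ?connect0 // => _; last first.
- have /all_const Dw : forall j, w j = Some false.
    move=> j; apply/eqP; have: stuck false j; last by case/andP.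
    apply: (ord_pred_closed (i := i)) => [|k /andP[/eqP wk /next]].
      by rewrite /stuck wi eqxx.
    rewrite wk /stuck /= => nc; rewrite nc andbT.
    have := ok (ord_pred k); rewrite ord_predK wk /compatible eqxx andbT.
    by case: (w _) (next _ nc) => [[]|] //=; rewrite connect0.
  by rewrite Dw eqxx in nL.
have /all_const Dw : forall j, w j = Some true.
  move=> j; apply/eqP; have: stuck true j; last by case/andP.
  apply: (ordS_closed (i := i)) => [|k /andP[/eqP wk /next]].
    by rewrite /stuck wi eqxx.
  rewrite wk /stuck /= => nc; rewrite nc andbT.
  have := ok k; rewrite wk /compatible eqxx /=.
  by case: (w _) (next _ nc) => [[]|] //=; rewrite connect0.
by rewrite Dw eqxx in nR.
Qed.

Lemma tau_wheel_words : tau (wheel n) = #|wheel_words|.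
Proof.
rewrite (tau_arborescences (None : wheel n)) -(card_imset _ word_parent_inj).
apply: eq_card => p; rewrite !inE; apply/andP/imsetP => [[arb_p /forall_inP adj_p] | [w ww ->]].
  (* A parent on the rim is the successor or the predecessor, and these differ, so one test recovers
     the letter. *)
  pose w := [ffun i => if p (Some i) is Some j then Some (j == ordS i) else None].
  have Dp : p = word_parent w.
    apply/ffunP=> -[i|]; rewrite !ffunE; last by case/andP: arb_p => /eqP.
    have := adj_p (Some i); rewrite !inE => /(_ isT).
    case: (p (Some i)) => [j|] //= /andP[_].
    case/orP=> /eqP->; rewrite ?eqxx //.
    by rewrite eq_sym (negPf (ordS2_neq _)) /= ordSK.
  by exists w; rewrite // -word_parent_arborescence -Dp.
split; first by rewrite word_parent_arborescence.
apply/forall_inP=> -[i|]; rewrite !inE // => _; rewrite ffunE.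
rewrite /adj /= /symm_rel /=; case: (w i) => [[]|] //=.
  by rewrite eqxx andbT; apply: contraNneq (ordS_neq i) => -[<-].
rewrite ord_predK eqxx orbT andbT.
by apply: contraNneq (ordS_neq (ord_pred i)) => -[{1}->]; rewrite ord_predK.
Qed.

End WheelTrees.

Lemma card_cyclic_words k : #|cyclic_words k.+1| = lucas k.+1.*2.
Proof.
rewrite -card_cyclic_tuples.
pose f (t : k.+1.-tuple letter) := [ffun i => tnth t i].
have f_inj : injective f.
  by move=> t u /ffunP Dtu; apply: eq_from_tnth => i; have := Dtu i; rewrite !ffunE.
rewrite -(card_imset _ f_inj); apply: eq_card => w; rewrite inE.
have Dw : w = f [tuple w i | i < k.+1] by apply/ffunP=> i; rewrite ffunE tnth_mktuple.
rewrite [in RHS]Dw mem_imset // inE cycle_tnth.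
by apply: eq_forallb => i; rewrite !tnth_mktuple.
Qed.

Lemma tau_wheel n : 2 < n -> tau (wheel n) = lucas (2 * n) - 2.
Proof.
move=> n_gt2; rewrite tau_wheel_words // mul2n; case: n n_gt2 => // k _.
rewrite -card_cyclic_words.
rewrite -(cardsID [set [ffun=> Some true]; [ffun=> Some false]] (cyclic_words k.+1)).
rewrite (setIidPr _) ?cards2; last first.
  by apply/subsetP=> w /set2P[]->; rewrite inE; apply/forallP=> i; rewrite !ffunE.
suff -> : [ffun=> Some true] != [ffun=> Some false] :> {ffun 'I_k.+1 -> letter} by rewrite addKn.
by apply/eqP=> /ffunP/(_ ord0); rewrite !ffunE.
Qed.

(** * Counts along the wheel model *)

Section WheelModel.
Variables (m n : nat) (rim : forall G : sgraph, G -> 'I_n).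
Hypotheses (m_gt1 : 1 < m) (n_gt2 : 2 < n).

Lemma tau_wheel_step (G : sgraph) : G ->
  tau (wheel_step m rim G) =
  tau G * m ^ (#|edge_set G| - #|G|.-1) * (lucas (2 * n) - 2) ^ #|G|.
Proof.
move=> x; rewrite -tau_edge_path // -tau_wheel //.
exact: tau_attach (edge_path_presents G m_gt1) (wheel_presents n_gt2).
Qed.

Lemma card_wheel_step (G : sgraph) :
  #|wheel_step m rim G| = #|G| + #|edge_set G| * m.-1 + #|G| * n.
Proof. by rewrite card_attach_vert card_edge_path_vert // card_wheel. Qed.

Lemma card_wheel_step_edges (G : sgraph) :
  #|edge_set (wheel_step m rim G)| = #|edge_set G| * m + #|G| * n.*2.
Proof.
rewrite -(card_wheel_edges n_gt2) -card_edge_path_edges //.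
exact: card_attach_edges (edge_path_presents G m_gt1) (wheel_presents n_gt2).
Qed.

Lemma wheel_model_vertex i : wheel_model m rim i.
Proof. by elim: i => [|i x]; [exact: None | exact: inl (inl x)]. Qed.

(** Subdivision keeps the cyclomatic number [#|E| - #|V| + 1], and each attached wheel adds [n] to
    it. The additive form avoids truncated subtraction. *)
Lemma wheel_model_cyclomatic i :
  #|edge_set (wheel_model m rim i)| + 1 =
  #|wheel_model m rim i| + n * \sum_(0 <= j < i.+1) order_V m rim j.
Proof.
elim: i => [|i IHi].
  by rewrite big_nat1 /= card_wheel_edges // card_wheel; lia.
rewrite big_nat_recr //= card_wheel_step card_wheel_step_edges; move: IHi.
rewrite -/(wheel_model m rim i) mulnDr; set e := #|edge_set _|.
(* Splitting [e * m] as [e + e * m.-1] cancels the links against the vertices inserted by the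
   subdivision. *)
have := mulnS e m.-1; rewrite (ltn_predK m_gt1) -addnn mulnDr (mulnC n #|_|).
by move: #|_| (_ * _) (\sum_(_ <= _ < _) _) => V *; lia.
Qed.

End WheelModel.

Theorem theorem3 (n m : nat) (hn : 3 <= n) (hm : 2 <= m)
    (rim : forall G : sgraph, G -> 'I_n) (i : nat) :
  tau (wheel_model m rim i) =
  (lucas (2 * n) - 2) ^ (\sum_(0 <= j < i.+1) order_V m rim j)
  * m ^ (n * \sum_(0 <= j < i.+1) (i - j) * order_V m rim j).
Proof.
elim: i => [|i IHi].
  by rewrite !big_nat1 subnn mul0n muln0 expn1 muln1 tau_wheel.
have [V_gt0 cyc] : 0 < #|wheel_model m rim i| /\ _ :=
  conj (introT card_gt0P (ex_intro _ (wheel_model_vertex m rim i) isT))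
       (wheel_model_cyclomatic rim hm hn i).
rewrite [wheel_model m rim i.+1]/= -/(wheel_model m rim i) tau_wheel_step //; last first.
  exact: wheel_model_vertex.
(* The exponent created by the subdivision is the cyclomatic number; [V_gt0] makes the predecessor
   exact. *)
have -> : #|edge_set (wheel_model m rim i)| - #|wheel_model m rim i|.-1 =
          n * \sum_(0 <= j < i.+1) order_V m rim j by lia.
(* Passing from [i] to [i.+1] raises each weight [i - j] by one, and the new last term has weight
   0. *)
have -> : \sum_(0 <= j < i.+2) (i.+1 - j) * order_V m rim j =
    \sum_(0 <= j < i.+1) (i - j) * order_V m rim j + \sum_(0 <= j < i.+1) order_V m rim j.
  rewrite big_nat_recr //= subnn mul0n addn0 -big_split /=.
  by apply: eq_big_nat => j /andP[_ le_ji]; rewrite subSn // mulSn addnC.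
rewrite IHi [in RHS]big_nat_recr //= mulnDr !expnD.
by rewrite -!mulnA; congr (_ * _); rewrite mulnA mulnC.
Qed.
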